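(* Let $k$ be an algebraically closed field. A connected, skeletal finite EI category $\mathcal{C}$ is of infinite representation type if it has a full subcategory $\mathcal{D}$ of infinite representation type.
   Context: A finite EI category is a small category with finitely many morphisms in which every endomorphism is an isomorphism. It is skeletal if isomorphic objects are equal, and connected if any two objects are joined by a finite chain of objects in which consecutive ones have a morphism between them in some direction. The category algebra $k\mathcal{C}$ has the morphisms of $\mathcal{C}$ as a $k$-basis, with product $\alpha*\beta=\alpha\circ\beta$ if composable and $0$ otherwise. A finite EI category is of finite (resp. infinite) representation type if its category algebra over $k$ has finitely (resp. infinitely) many isomorphism classes of indecomposable finitely generated left modules. *)

(* Defs.v *)
From HB Require Import structures.
From mathcomp Require Import all_boot all_order all_algebra.

Set Implicit Arguments.
Unset Strict Implicit.
Unset Printing Implicit Defensive.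

Import GRing.Theory.
Local Open Scope ring_scope.

(* Finitely many morphisms force finitely many objects, through identities. *)
Record finCat := FinCat {
  obj :> finType;
  hom : obj -> obj -> finType;
  idm : forall x, hom x x;
  comp : forall x y z, hom y z -> hom x y -> hom x z;
  compA : forall x y z t (a : hom z t) (b : hom y z) (c : hom x y),
    comp a (comp b c) = comp (comp a b) c;
  comp1m : forall x y (a : hom x y), comp (idm y) a = a;
  compm1 : forall x y (a : hom x y), comp a (idm x) = a
}.

Arguments hom {C} x y : rename.
Arguments idm {C} x : rename.
Arguments comp {C x y z} a b : rename.

Definition is_iso (C : finCat) (x y : C) (a : hom x y) : Prop :=
  exists b : hom y x, comp b a = idm x /\ comp a b = idm y.

Definition is_EI (C : finCat) : Prop :=
  forall (x : C) (a : hom x x), is_iso a.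

Definition skeletal (C : finCat) : Prop :=
  forall (x y : C) (a : hom x y), is_iso a -> x = y.

Definition linked (C : finCat) : rel C :=
  fun x y => (0 < #|{: hom x y}|)%N || (0 < #|{: hom y x}|)%N.

(* [connect] is the reflexive transitive closure.  The empty category counts
   as connected; its algebra is zero, hence of finite representation type. *)
Definition connected (C : finCat) : Prop :=
  forall x y : C, connect (@linked C) x y.

Section FullSubcategory.
Variables (C : finCat) (D : {set C}).

Definition full_subcat : finCat :=
  @FinCat {x : C | x \in D}
    (fun x y => hom (val x) (val y))
    (fun x => idm (val x))
    (fun x y z => @comp C (val x) (val y) (val z))
    (fun x y z t => @compA C (val x) (val y) (val z) (val t))
    (fun x y => @comp1m C (val x) (val y))
    (fun x y => @compm1 C (val x) (val y)).

Lemma full_subcat_EI : is_EI C -> is_EI full_subcat.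
Proof. by move=> hEI x a; apply: hEI. Qed.

End FullSubcategory.

Definition mor (C : finCat) : Type := {p : C * C & hom p.1 p.2}.
HB.instance Definition _ (C : finCat) :=
  Finite.copy (mor C) {p : C * C & hom p.1 p.2}.

Definition arr (C : finCat) (x y : C) (a : hom x y) : mor C :=
  existT (fun p : C * C => hom p.1 p.2) (x, y) a.

(* An element of k C is its family of coefficients on the basis of morphisms.
   The alias hides the pointwise product that MathComp puts on {ffun _ -> k}. *)
Definition catalg (k : fieldType) (C : finCat) : Type := {ffun mor C -> k}.
HB.instance Definition _ (k : fieldType) (C : finCat) :=
  GRing.Lmodule.copy (catalg k C) {ffun mor C -> k^o}.

Section CategoryAlgebra.
Variables (k : fieldType) (C : finCat).
Implicit Types f g h : catalg k C.

Definition catalg_basis (m : mor C) : catalg k C := [ffun n => (n == m)%:R].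

Definition catalg_one : catalg k C :=
  [ffun m => (m == arr (idm (tag m).1))%:R].

(* Bilinear extension of composition: see catalg_basisM and catalg_basisM0. *)
Definition catalg_mul f g : catalg k C :=
  [ffun m : mor C => \sum_(y : C) \sum_(b : hom (tag m).1 y)
     \sum_(a : hom y (tag m).2 | comp a b == tagged m)
       f (arr a) * g (arr b)].

Lemma catalg_mulE f g (x z : C) (c : hom x z) :
  catalg_mul f g (arr c) = \sum_(y : C) \sum_(b : hom x y)
     \sum_(a : hom y z | comp a b == c) f (arr a) * g (arr b).
Proof. by rewrite ffunE. Qed.

Lemma arr_inj (x y : C) : injective (@arr C x y).
Proof. by move=> a b /eqP; rewrite /arr eq_Tagged => /eqP. Qed.

Lemma catalgP f g :
  (forall (x y : C) (a : hom x y), f (arr a) = g (arr a)) -> f = g.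
Proof. by move=> e; apply/ffunP => -[[x y] a]; apply: e. Qed.

Lemma catalg_mulA : associative catalg_mul.
Proof.
move=> f g h; apply: catalgP => x t c; rewrite !catalg_mulE.
pose T y z (b : hom x y) (a : hom y z) (e : hom z t) :=
  if comp e (comp a b) == c then f (arr e) * g (arr a) * h (arr b) else 0.
transitivity (\sum_(y : C) \sum_(z : C) \sum_(b : hom x y)
  \sum_(a : hom y z) \sum_(e : hom z t) T y z b a e).
  rewrite [RHS]exchange_big; apply: eq_bigr => z _.
  transitivity (\sum_(d : hom x z) \sum_(y : C) \sum_(b : hom x y)
     \sum_(a : hom y z) \sum_(e : hom z t)
       if comp a b == d then T y z b a e else 0).
    apply: eq_bigr => d _; under eq_bigr => e _ do
      rewrite catalg_mulE mulr_sumr.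
    rewrite exchange_big; apply: eq_bigr => y _.
    under eq_bigr => e _ do rewrite mulr_sumr.
    rewrite exchange_big; apply: eq_bigr => b _.
    under eq_bigr => e _ do rewrite mulr_sumr big_mkcond.
    rewrite exchange_big; apply: eq_bigr => a _.
    rewrite big_mkcond; apply: eq_bigr => e _.
    rewrite /T; case: (comp a b =P d) => [->|_]; last by case: ifP.
    by rewrite mulrA.
  rewrite exchange_big; apply: eq_bigr => y _.
  rewrite exchange_big; apply: eq_bigr => b _.
  rewrite exchange_big; apply: eq_bigr => a _.
  rewrite exchange_big; apply: eq_bigr => e _.
  rewrite -big_mkcond (bigD1 (comp a b)) //= big1 ?addr0 // => d /andP[].
  by move=> /eqP-> /eqP.
apply: eq_bigr => y _; rewrite exchange_big; apply: eq_bigr => b _.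
transitivity (\sum_(d : hom y t) \sum_(z : C) \sum_(a : hom y z)
   \sum_(e : hom z t) if comp e a == d then T y z b a e else 0).
  rewrite [RHS]exchange_big; apply: eq_bigr => z _.
  rewrite [RHS]exchange_big; apply: eq_bigr => a _.
  rewrite [RHS]exchange_big; apply: eq_bigr => e _.
  rewrite -big_mkcond (bigD1 (comp e a)) //= big1 ?addr0 // => d /andP[].
  by move=> /eqP-> /eqP.
rewrite [RHS]big_mkcond; apply: eq_bigr => d _.
case: ifP => dbc; last first.
  rewrite big1 // => z _; rewrite big1 // => a _; rewrite big1 // => e _.
  by rewrite /T compA; case: eqP => // ->; rewrite dbc.
rewrite catalg_mulE mulr_suml; apply: eq_bigr => z _.
rewrite mulr_suml; apply: eq_bigr => a _.
rewrite mulr_suml [RHS]big_mkcond; apply: eq_bigr => e _.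
by rewrite /T compA; case: eqP => // ->; rewrite dbc.
Qed.

Lemma catalg_oneE (x y : C) (a : hom x y) :
  catalg_one (arr a) = (arr a == arr (idm x))%:R.
Proof. by rewrite ffunE. Qed.

Lemma arr_tag (x y z t : C) (a : hom x y) (b : hom z t) :
  arr a = arr b -> x = z /\ y = t.
Proof. by move=> /(congr1 tag) [-> ->]. Qed.

Lemma catalg_mul1 : left_id catalg_one catalg_mul.
Proof.
move=> f; apply: catalgP => x z c; rewrite catalg_mulE (bigD1 z) //=.
rewrite [X in _ + X]big1 ?addr0 => [|y yz]; last first.
  rewrite big1 // => b _; rewrite big1 // => a _; rewrite catalg_oneE.
  case: eqP => [/arr_tag[_ zy]|_]; last by rewrite mul0r.
  by rewrite zy eqxx in yz.
rewrite (bigD1 c) //= (bigD1 (idm z)) ?comp1m //=.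
rewrite catalg_oneE eqxx mul1r big1 ?addr0 => [|a /andP[_ az]].
  rewrite big1 ?addr0 // => b bc; rewrite big1 // => a /eqP abc.
  rewrite catalg_oneE; case: eqP => [/arr_inj az|_]; last by rewrite mul0r.
  by rewrite -abc az comp1m eqxx in bc.
rewrite catalg_oneE; case: eqP => [/arr_inj e|_]; last by rewrite mul0r.
by rewrite e eqxx in az.
Qed.

Lemma catalg_mulr1 : right_id catalg_one catalg_mul.
Proof.
move=> f; apply: catalgP => x z c; rewrite catalg_mulE (bigD1 x) //=.
rewrite [X in _ + X]big1 ?addr0 => [|y yz]; last first.
  rewrite big1 // => b _; rewrite big1 // => a _; rewrite catalg_oneE.
  case: eqP => [/arr_tag[_ zy]|_]; last by rewrite mulr0.
  by rewrite zy eqxx in yz.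
rewrite (bigD1 (idm x)) //= (bigD1 c) ?compm1 //=.
rewrite catalg_oneE eqxx mulr1 big1 ?addr0 => [|a].
  rewrite big1 ?addr0 // => b bx; rewrite big1 // => a _.
  rewrite catalg_oneE; case: eqP => [/arr_inj e|_]; last by rewrite mulr0.
  by rewrite e eqxx in bx.
by rewrite compm1 andbN.
Qed.

Lemma catalg_mulDl : left_distributive catalg_mul +%R.
Proof.
move=> f g h; apply: catalgP => x z c; rewrite [RHS]ffunE !catalg_mulE -big_split.
apply: eq_bigr => y _; rewrite -big_split; apply: eq_bigr => b _.
by rewrite -big_split; apply: eq_bigr => a _; rewrite [X in X * _ = _]ffunE mulrDl.
Qed.

Lemma catalg_mulDr : right_distributive catalg_mul +%R.
Proof.
move=> f g h; apply: catalgP => x z c; rewrite [RHS]ffunE !catalg_mulE -big_split.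
apply: eq_bigr => y _; rewrite -big_split; apply: eq_bigr => b _.
by rewrite -big_split; apply: eq_bigr => a _; rewrite [X in _ * X = _]ffunE mulrDr.
Qed.

HB.instance Definition _ := GRing.Zmodule_isPzRing.Build (catalg k C)
  catalg_mulA catalg_mul1 catalg_mulr1 catalg_mulDl catalg_mulDr.

Lemma catalgME f g (x z : C) (c : hom x z) :
  (f * g) (arr c) = \sum_(y : C) \sum_(b : hom x y)
     \sum_(a : hom y z | comp a b == c) f (arr a) * g (arr b).
Proof. exact: catalg_mulE. Qed.

(* These make k C a k-algebra; MathComp's algType k would require it nonzero. *)
Lemma catalg_scaleAl (c : k) f g : c *: (f * g) = (c *: f) * g.
Proof.
apply: catalgP => x z e; rewrite [LHS]ffunE !catalgME scaler_sumr.
apply: eq_bigr => y _; rewrite scaler_sumr; apply: eq_bigr => b _.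
by rewrite scaler_sumr; apply: eq_bigr => a _; rewrite ffunE; apply: mulrA.
Qed.

Lemma catalg_scaleAr (c : k) f g : c *: (f * g) = f * (c *: g).
Proof.
apply: catalgP => x z e; rewrite [LHS]ffunE !catalgME scaler_sumr.
apply: eq_bigr => y _; rewrite scaler_sumr; apply: eq_bigr => b _.
by rewrite scaler_sumr; apply: eq_bigr => a _; rewrite ffunE; apply: mulrCA.
Qed.

Lemma catalg_basisM (x y z : C) (a : hom y z) (b : hom x y) :
  catalg_basis (arr a) * catalg_basis (arr b) = catalg_basis (arr (comp a b)).
Proof.
apply: catalgP => s t c; rewrite catalgME [RHS]ffunE.
have [/[dup] ec /arr_tag[es et]|nc] := arr c =P arr (comp a b).
  subst s t; move/arr_inj: ec => ->.
  rewrite (bigD1 y) //= [X in _ + X]big1 ?addr0 => [|w wy]; last first.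
    rewrite big1 // => b' _; rewrite big1 // => a' _; rewrite !ffunE.
    case: eqP => [/arr_tag[e _]|_]; last by rewrite mul0r.
    by rewrite e eqxx in wy.
  rewrite (bigD1 b) //= [X in _ + X]big1 ?addr0 => [|b' bb]; last first.
    rewrite big1 // => a' _; rewrite !ffunE.
    case: (arr b' =P arr b) => [/arr_inj e|_]; last by rewrite mulr0.
    by rewrite e eqxx in bb.
  rewrite (bigD1 a) //= big1 ?addr0 ?ffunE ?eqxx ?mulr1 // => a' /andP[_ aa].
  rewrite !ffunE; case: eqP => [/arr_inj e|_]; last by rewrite mul0r.
  by rewrite e eqxx in aa.
rewrite big1 // => w _; rewrite big1 // => b' _.
rewrite big1 // => a' /eqP abc; rewrite !ffunE.
case: eqP => [|_]; last by rewrite mul0r.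
case: eqP => [|_]; last by rewrite mulr0.
move=> /[dup] eb /arr_tag[es ew] /[dup] ea /arr_tag[_ et]; subst s w t.
by case: nc; rewrite -abc (arr_inj ea) (arr_inj eb).
Qed.

Lemma catalg_basisM0 (x y y' z : C) (a : hom y' z) (b : hom x y) :
  y != y' -> catalg_basis (arr a) * catalg_basis (arr b) = 0.
Proof.
move=> yy; apply: catalgP => s t c; rewrite catalgME [RHS]ffunE.
rewrite big1 // => w _; rewrite big1 // => b' _; rewrite big1 // => a' _.
rewrite !ffunE; case: eqP => [/arr_tag[wy' _]|_]; last by rewrite mul0r.
case: eqP => [/arr_tag[_ wy]|_]; last by rewrite mulr0.
by rewrite -wy -wy' eqxx in yy.
Qed.

End CategoryAlgebra.

Section RepresentationType.
Variable A : pzRingType.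

Definition finitely_generated (M : lmodType A) : Prop :=
  exists (n : nat) (g : 'I_n -> M),
    forall v : M, exists c : 'I_n -> A, v = \sum_(i < n) c i *: g i.

Definition isomorphic (M N : lmodType A) : Prop :=
  exists f : {linear M -> N}, bijective f.

Definition zero_module (M : lmodType A) : Prop := forall v : M, v = 0.

Definition indecomposable (M : lmodType A) : Prop :=
  ~ zero_module M /\
  forall U V : lmodType A, isomorphic M (U * V)%type ->
    zero_module U \/ zero_module V.

(* Some finite family meets every isomorphism class of finitely generated
   indecomposable left modules. *)
Definition finite_rep_type : Prop :=
  exists (n : nat) (F : 'I_n -> lmodType A),
    (forall i, finitely_generated (F i) /\ indecomposable (F i)) /\
    forall M : lmodType A, finitely_generated M -> indecomposable M ->
      exists i, isomorphic M (F i).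

End RepresentationType.

Definition infinite_representation_type (k : fieldType) (C : finCat) : Prop :=
  ~ finite_rep_type (catalg k C).

(* Main.v *)
(* The algebra of the full subcategory on D is the corner e(kC)e, where e is
   the sum of the identities of D.  Every finitely generated kD-module M is
   isomorphic to eX for a finitely generated kC-module X.  Take such an X,
   spanned over k by as few vectors as possible, with M indecomposable: if X
   is a direct sum of U and V, then M is the direct sum of eU and eV, hence
   M = eU or M = eV, so that V or U vanishes by minimality.  Thus X is
   indecomposable, and the finitely many modules eX, for X running through the
   indecomposable kC-modules, account for all indecomposable kD-modules. *)

From HB Require Import structures.
From mathcomp Require Import all_boot all_order all_algebra.
From mathcomp Require Import boolp functions.
Require Import Defs.

Set Implicit Arguments.
Unset Strict Implicit.
Unset Printing Implicit Defensive.

Import GRing.Theory.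
Local Open Scope ring_scope.

(** * Isomorphisms and direct sums of modules *)

Section Isomorphism.
Variable A : pzRingType.
Implicit Types M N P U V : lmodType A.

Lemma linear_isomorphic M N (f : M -> N) :
  linear f -> bijective f -> isomorphic M N.
Proof.
move=> f_lin f_bij.
pose F : {linear M -> N} := HB.pack f (GRing.isLinear.Build _ _ _ _ f f_lin).
by exists F.
Qed.

Lemma isomorphic_sym M N : isomorphic M N -> isomorphic N M.
Proof.
move=> [f [g fK gK]]; apply: (@linear_isomorphic _ _ g); last by exists f.
exact: can2_linear fK gK.
Qed.

Lemma isomorphic_trans M N P :
  isomorphic M N -> isomorphic N P -> isomorphic M P.
Proof.
move=> [f f_bij] [g g_bij]; exists (g \o f)%FUN.
exact: bij_comp.
Qed.

Lemma isomorphic_zero M N : isomorphic M N -> zero_module M -> zero_module N.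
Proof.
move=> [f [g fK gK]] M0 v; rewrite -(gK v) (M0 (g v)); exact: raddf0.
Qed.

Lemma prod0_isomorphic U V : zero_module V -> isomorphic (U * V)%type U.
Proof.
move=> V0; apply: (@linear_isomorphic _ _ fst) => [a [u v] [u' v'] //|].
by exists (fun u => (u, 0)) => // -[u v]; rewrite (V0 v).
Qed.

Lemma prodC_isomorphic U V : isomorphic (U * V)%type (V * U)%type.
Proof.
apply: (@linear_isomorphic _ _ (fun p => (p.2, p.1))) => //.
by exists (fun p => (p.2, p.1)) => -[].
Qed.

Lemma isomorphic_indecomposable M N :
  isomorphic M N -> indecomposable M -> indecomposable N.
Proof.
move=> MN [M0 Mdec]; split.
  by move=> N0; apply/M0/(isomorphic_zero _ N0)/isomorphic_sym.
by move=> U V NUV; apply/Mdec/(isomorphic_trans MN).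
Qed.

Lemma isomorphic_finitely_generated M N :
  isomorphic M N -> finitely_generated M -> finitely_generated N.
Proof.
move=> [f [f' fK f'K]] [n [g gP]]; exists n, (f \o g) => v.
have [c ec] := gP (f' v); exists c; rewrite -(f'K v) ec linear_sum.
by apply: eq_bigr => i _; rewrite linearZ.
Qed.

End Isomorphism.

(** * Spanning families over the ground field *)

Section ScalarSpan.
Variables (k : fieldType) (A : pzRingType) (eta : {rmorphism k -> A}).
Implicit Types X U V : lmodType A.

(** With [k] acting through [eta], this bounds the dimension of [X] over [k] by [n]. *)
Definition spanned n X : Prop := exists g : 'I_n -> X,
  forall v, exists c : 'I_n -> k, v = \sum_i eta (c i) *: g i.

Lemma spanned_fintype (I : finType) X (g : I -> X) :
  (forall v, exists c : I -> k, v = \sum_i eta (c i) *: g i) ->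
  spanned #|I| X.
Proof.
move=> gP; exists (g \o enum_val) => v; have [c ->] := gP v.
by exists (c \o enum_val); rewrite big_enum_val.
Qed.

Lemma spanned_finitely_generated n X : spanned n X -> finitely_generated X.
Proof.
move=> [g gP]; exists n, g => v; have [c ->] := gP v.
by exists (eta \o c).
Qed.

(** The products [b t *: g i], for module generators [g i], span over [k]. *)
Lemma finitely_generated_spanned (T : finType) (b : T -> A) X :
  (forall a, exists c : T -> k, a = \sum_t eta (c t) * b t) ->
  finitely_generated X -> exists n, spanned n X.
Proof.
move=> bP [n [g gP]]; exists #|{: 'I_n * T}|.
apply: (@spanned_fintype ('I_n * T)%type _ (fun p => b p.2 *: g p.1)) => v.
have [a ->] := gP v; have [c cP] := choice (fun i => bP (a i)).
exists (fun p => c p.1 p.2).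
rewrite -(pair_bigA _ (fun i t => eta (c i t) *: (b t *: g i))).
apply: eq_bigr => i _; rewrite [in LHS](cP i) scaler_suml.
by apply: eq_bigr => t _; rewrite scalerA.
Qed.

(* A nonzero vector of [V] gives a nontrivial relation between the [U]
   components of the generators, so one of these components is redundant. *)
Lemma spanned_summand n X U V :
  isomorphic X (U * V)%type -> ~ zero_module V -> spanned n X ->
  spanned n.-1 U.
Proof.
move=> [f [f' fK f'K]] V0 [g gP].
have span_f w : exists c : 'I_n -> k, w = \sum_i eta (c i) *: f (g i).
  have [c ec] := gP (f' w); exists c; rewrite -(f'K w) ec linear_sum.
  by apply: eq_bigr => i _; rewrite linearZ.
have fst_sum (c : 'I_n -> k) : (\sum_i eta (c i) *: f (g i)).1 =
    \sum_i eta (c i) *: (f (g i)).1.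
  by rewrite (raddf_sum fst).
have [v v_neq0] : exists v : V, v <> 0 by apply/existsNP.
(* The [U] component of [(0, v)] is zero, so this expansion projects to a relation in [U]; it is
   nontrivial because [v] is nonzero. *)
have [c ec] := span_f (0, v).
case: (pickP (fun i => c i != 0)) => [i0 ci0 | c0]; last first.
  case: v_neq0; rewrite -[v]/((0 : U, v).2) ec big1 // => i _.
  by have /negbFE/eqP-> := c0 i; rewrite rmorph0 scale0r.
have rel : eta (c i0) *: (f (g i0)).1 =
    - \sum_j eta (c (lift i0 j)) *: (f (g (lift i0 j))).1.
  apply/eqP; rewrite -addr_eq0; apply/eqP.
  by have := fst_sum c; rewrite -ec (bigD1_ord i0).
exists (fun j => (f (g (lift i0 j))).1) => u.
have [d ed] := span_f (u, 0).
(* These coefficients come from solving [rel] for the component of index [i0] and substituting it in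
   the expansion of [u]. *)
exists (fun j => d (lift i0 j) - d i0 / c i0 * c (lift i0 j)).
have := fst_sum d; rewrite -ed (bigD1_ord i0) //= => ->.
rewrite -{1}(divfK ci0 (d i0)) rmorphM -scalerA rel scalerN scaler_sumr.
rewrite addrC -sumrB; apply: eq_bigr => j _.
by rewrite rmorphB scalerBl (rmorphM _ (_ / _)) scalerA.
Qed.

End ScalarSpan.

(** * Restriction of modules along a multiplicative map that may not preserve 1 *)

Section Corner.
Variables (A B : pzRingType) (iota : {additive B -> A}).
Hypothesis iotaM : {morph iota : x y / x * y}.

Section Restriction.
Variable X : lmodType A.

(** As e = [iota 1] is idempotent, its fixed vectors form eX. *)
Definition fixed_pred : pred X := fun v => iota 1 *: v == v.

Fact fixed_zmod_closed : zmod_closed fixed_pred.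
Proof.
split=> [|u v /eqP u_fix /eqP v_fix]; first exact/eqP/scaler0.
by apply/eqP; rewrite scalerBr u_fix v_fix.
Qed.
HB.instance Definition _ :=
  GRing.isZmodClosed.Build X fixed_pred fixed_zmod_closed.

(* [iotaM] is a parameter because the module structure depends on it. *)
Definition restriction of {morph iota : x y / x * y} : Type :=
  {v : X | v \in fixed_pred}.
Local Notation res := (restriction iotaM).
HB.instance Definition _ := [isSub of res for @sval _ _].
HB.instance Definition _ := [Choice of res by <:].
HB.instance Definition _ := [SubChoice_isSubZmodule of res by <:].

Fact res_scale_subproof (b : B) (v : res) : iota b *: \val v \in fixed_pred.
Proof. by apply/eqP; rewrite scalerA -iotaM mul1r. Qed.

Definition res_scale (b : B) (v : res) : res :=
  Sub (iota b *: \val v) (res_scale_subproof b v).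

Fact res_scaleA a b v : res_scale a (res_scale b v) = res_scale (a * b) v.
Proof. by apply: val_inj; rewrite !SubK scalerA -iotaM. Qed.

Fact res_scale1 : left_id 1 res_scale.
Proof. by move=> v; apply: val_inj; rewrite SubK; apply/eqP/(valP v). Qed.

Fact res_scaleDr : right_distributive res_scale +%R.
Proof. by move=> a u v; apply: val_inj; rewrite [RHS]raddfD /= scalerDr. Qed.

Fact res_scaleDl v : {morph res_scale^~ v : a b / a + b}.
Proof.
by move=> a b; apply: val_inj; rewrite [RHS]raddfD /= raddfD scalerDl.
Qed.

HB.instance Definition _ := GRing.Zmodule_isLmodule.Build B res
  res_scaleA res_scale1 res_scaleDr res_scaleDl.

Lemma val_resZ b (v : res) : \val (b *: v) = iota b *: \val v.
Proof. by []. Qed.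

Lemma val_res_fixed (v : res) : iota 1 *: \val v = \val v.
Proof. exact/eqP/(valP v). Qed.

Fact res_proj_subproof (v : X) : iota 1 *: v \in fixed_pred.
Proof. by apply/eqP; rewrite scalerA -iotaM mul1r. Qed.

Definition res_proj (v : X) : res := Sub (iota 1 *: v) (res_proj_subproof v).

End Restriction.

Local Notation res X := (restriction X iotaM).

(** The values of [f] lie in eX because f(u) = f(1u) = e f(u), so [g] has to invert [f] on eX only.
    The later isomorphisms with restrictions are built from maps into [X] itself in this way. *)
Lemma embedding_restriction (M : lmodType B) (X : lmodType A)
    (f : M -> X) (g : X -> M) :
  {morph f : u v / u + v} -> (forall b u, f (b *: u) = iota b *: f u) ->
  cancel f g -> (forall v, iota 1 *: v = v -> f (g v) = v) ->
  isomorphic M (res X).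
Proof.
move=> fD fZ fK gK.
have f_fixed u : f u \in @fixed_pred X by apply/eqP; rewrite -fZ scale1r.
apply: (@linear_isomorphic _ _ (res X) (fun u => Sub (f u) (f_fixed u))).
  by move=> b u v; apply: val_inj; rewrite [RHS]raddfD /= fD fZ.
exists (g \o val) => [u|v]; first exact: fK.
by apply/val_inj/gK/val_res_fixed.
Qed.

Lemma restriction_isomorphic (X Y : lmodType A) :
  isomorphic X Y -> isomorphic (res X) (res Y).
Proof.
move=> [f [f' fK f'K]].
apply: (@embedding_restriction (res X) Y (f \o val) (fun v => res_proj (f' v))).
- by move=> u v /=; rewrite !raddfD.
- by move=> b u /=; rewrite linearZ.
- by move=> u; apply: val_inj; rewrite /= fK val_res_fixed.
- by move=> v /= v_fix; rewrite linearZ /= f'K.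
Qed.

Lemma restriction_prod (X U V : lmodType A) :
  isomorphic X (U * V)%type -> isomorphic (res X) (res U * res V)%type.
Proof.
move=> /isomorphic_sym [f [f' fK f'K]]; apply: isomorphic_sym.
apply: (@embedding_restriction (res U * res V)%type X
  (fun p => f (val p.1, val p.2))
  (fun v => (res_proj (f' v).1, res_proj (f' v).2))).
- by move=> u v; rewrite -raddfD.
- by move=> b u; rewrite -linearZ.
- by case=> u v; rewrite fK; congr (_, _); apply: val_inj; exact: val_res_fixed.
- move=> v v_fix; transitivity (f (iota 1 *: f' v)); first by [].
  by rewrite linearZ f'K.
Qed.

(** * A finitely generated module with prescribed restriction *)

Section Induction.
(** The model is the compression of a to eae, read in [B]. The hypotheses make [rho] a left inverse
    of [iota] that is linear over [B] on both sides. *)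
Variable rho : {additive A -> B}.
Hypotheses (rho1 : rho 1 = 1)
  (rhoM : forall x b y, rho (x * iota b * y) = rho x * b * rho y).
Variables (M : lmodType B) (n : nat) (g : 'I_n -> M).

(* With e = [iota 1], these are the images of Ae (x)_B M in Hom_B(eA, M): being
   generated by the image of M, they form a finitely generated module, which is
   less clear for Hom_B(eA, M) itself. *)
Definition induced_fun (a : 'I_n -> A) : A -> M :=
  fun x => \sum_i rho (x * a i) *: g i.

Definition induced_pred : pred (A -> M) :=
  fun phi => `[< exists a, phi = induced_fun a >].

Fact induced_zmod_closed : zmod_closed induced_pred.
Proof.
split=> [|_ _ /asboolP[a ->] /asboolP[a' ->]]; apply/asboolP.
  exists (fun=> 0); apply/funext => x; rewrite /induced_fun big1 // => i _.
  by rewrite mulr0 raddf0 scale0r.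
exists (fun i => a i - a' i); apply/funext => x.
rewrite /induced_fun -[LHS]sumrB; apply: eq_bigr => i _.
by rewrite mulrBr raddfB scalerBl.
Qed.
HB.instance Definition _ :=
  GRing.isZmodClosed.Build (A -> M) induced_pred induced_zmod_closed.

Definition induced : Type := {phi : A -> M | phi \in induced_pred}.
HB.instance Definition _ := [isSub of induced for @sval _ _].
HB.instance Definition _ := [Choice of induced by <:].
HB.instance Definition _ := [SubChoice_isSubZmodule of induced by <:].

Fact induced_scale_subproof (c : A) (phi : induced) :
  (fun x => \val phi (x * c)) \in induced_pred.
Proof.
have /asboolP[a ->] := valP phi; apply/asboolP; exists (fun i => c * a i).
by apply/funext => x; apply: eq_bigr => i _; rewrite mulrA.
Qed.

Definition induced_scale (c : A) (phi : induced) : induced :=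
  Sub (fun x => \val phi (x * c)) (induced_scale_subproof c phi).

Fact induced_scaleA a b phi :
  induced_scale a (induced_scale b phi) = induced_scale (a * b) phi.
Proof. by apply/val_inj/funext => x /=; rewrite mulrA. Qed.

Fact induced_scale1 : left_id 1 induced_scale.
Proof. by move=> phi; apply/val_inj/funext => x /=; rewrite mulr1. Qed.

Fact induced_scaleDr : right_distributive induced_scale +%R.
Proof. by move=> a phi psi; apply/val_inj/funext. Qed.

(** This fails for arbitrary functions from [A] to [M]; those of the form [induced_fun a] are
    additive because [rho] is. *)
Fact induced_scaleDl phi : {morph induced_scale^~ phi : a b / a + b}.
Proof.
move=> a b; apply/val_inj/funext => x /=.
have /asboolP[c ->] := valP phi; rewrite -[RHS]big_split /=.
by apply: eq_bigr => i _; rewrite mulrDr mulrDl raddfD scalerDl.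
Qed.

HB.instance Definition _ := GRing.Zmodule_isLmodule.Build A induced
  induced_scaleA induced_scale1 induced_scaleDr induced_scaleDl.

Fact induced_gen_subproof i : (fun x => rho x *: g i) \in induced_pred.
Proof.
apply/asboolP; exists (fun j => (j == i)%:R); apply/funext => x.
rewrite /induced_fun (bigD1 i) //= eqxx mulr1 big1 ?addr0 // => j /negbTE->.
by rewrite mulr0 raddf0 scale0r.
Qed.

Definition induced_gen i : induced :=
  Sub (fun x => rho x *: g i) (induced_gen_subproof i).

Lemma induced_finitely_generated : finitely_generated induced.
Proof.
exists n, induced_gen => phi; have /asboolP[a ea] := valP phi.
by exists a; apply/val_inj/funext => x; rewrite raddf_sum fct_sumE ea.
Qed.

(** The vector m corresponds to the function sending x to rho(x)m, and evaluation at 1 is the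
    inverse. *)
Lemma restriction_induced :
  (forall v, exists c : 'I_n -> B, v = \sum_i c i *: g i) ->
  isomorphic M (res induced).
Proof.
move=> gP.
have m_ind (m : M) : (fun x => rho x *: m) \in induced_pred.
  have [c ->] := gP m; apply/asboolP; exists (fun i => iota (c i)).
  apply/funext => x; rewrite /induced_fun scaler_sumr; apply: eq_bigr => i _.
  by rewrite scalerA -[x * _]mulr1 rhoM rho1 mulr1.
apply: (@embedding_restriction M induced 
  (fun m => Sub (fun x => rho x *: m) (m_ind m) : induced)
  (fun phi => val phi 1)).
- by move=> u v; apply/val_inj/funext => x; apply: scalerDr.
- move=> b u; apply/val_inj/funext => x.
  transitivity (rho (x * iota b) *: u); last by [].
  by rewrite -[x * _]mulr1 rhoM rho1 mulr1 -scalerA.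
- by move=> m /=; rewrite rho1 scale1r.
(* If e fixes [phi], then phi(x) = phi(xe), and [rhoM] pulls rho(x) out of each term, leaving
   rho(x)phi(1). *)
- move=> phi phi_fix; apply/val_inj/funext => x.
  transitivity (rho x *: val phi 1); first by [].
  rewrite -[in RHS]phi_fix; transitivity (val phi (x * iota 1)); last by [].
  have /asboolP[a ->] := valP phi; rewrite /induced_fun scaler_sumr.
  by apply: eq_bigr => i _; rewrite scalerA rhoM mul1r mulr1.
Qed.

End Induction.

(** * Descent of finite representation type *)

Section FiniteType.
Variable rho : {additive A -> B}.
Hypotheses (rho1 : rho 1 = 1)
  (rhoM : forall x b y, rho (x * iota b * y) = rho x * b * rho y).
Variables (k : fieldType) (eta : {rmorphism k -> A}) (T : finType) (b : T -> A).
Hypothesis bP : forall a, exists c : T -> k, a = \sum_t eta (c t) * b t.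

(** Induction on the bound [n] replaces the choice of a minimal [X]: a decomposable [X] gives way to
    the summand that still restricts to [M], and dropping the other nonzero summand lowers the
    bound. *)
Lemma indecomposable_lift n (M : lmodType B) (X : lmodType A) :
    indecomposable M -> spanned eta n X -> isomorphic M (res X) ->
  exists Y : lmodType A,
    [/\ finitely_generated Y, indecomposable Y & isomorphic M (res Y)].
Proof.
move=> M_indec; elim: n X => [|n IHn] X spanX MX.
  (* A module spanned by no vectors is zero, and then so is [M]. *)
  case: M_indec.1; apply: isomorphic_zero (isomorphic_sym MX) _ => v.
  apply: val_inj; case: spanX => g /(_ (val v))[c ->]; exact: big_ord0.
have [X_indec|X_dec] := pselect (indecomposable X).
  by exists X; split=> //; apply: spanned_finitely_generated spanX.
have X0 : ~ zero_module X.
  move=> X0; apply: M_indec.1.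
  by apply: isomorphic_zero (isomorphic_sym MX) _ => v; apply/val_inj/X0.
have [U [V [XUV [U0 V0]]]] : exists U V : lmodType A,
    isomorphic X (U * V)%type /\ ~ zero_module U /\ ~ zero_module V.
  apply: contrapT => noUV; apply: X_dec; split=> // U V XUV.
  apply: contrapT => /not_orP[U0 V0]; apply: noUV.
  by exists U, V.
have MUV := isomorphic_trans MX (restriction_prod XUV).
have [resU0|resV0] := M_indec.2 _ _ MUV.
  have XVU := isomorphic_trans XUV (prodC_isomorphic _ _).
  apply: (IHn V); first exact: spanned_summand XVU U0 spanX.
  apply: isomorphic_trans MUV _.
  exact: isomorphic_trans (prodC_isomorphic _ _) (prod0_isomorphic _ resU0).
apply: (IHn U); first exact: spanned_summand XUV V0 spanX.
exact: isomorphic_trans MUV (prod0_isomorphic _ resV0).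
Qed.

Lemma corner_finite_rep_type : finite_rep_type A -> finite_rep_type B.
Proof.
move=> [n [F [_ Fall]]].
(* The restriction of an indecomposable module may be zero or decomposable, so the family must be
   filtered. *)
pose good j := finitely_generated (res (F j)) /\ indecomposable (res (F j)).
pose S := [set j | `[< good j >]].
exists #|S|, (fun i => res (F (enum_val i))); split=> [i|M M_fg M_indec].
  by have := enum_valP i; rewrite inE => /asboolP.
have [m [g gP]] := M_fg.
have [d spanX] :=
  finitely_generated_spanned bP (induced_finitely_generated rho g).
have [Y [Y_fg Y_indec MY]] :=
  indecomposable_lift M_indec spanX (restriction_induced rho1 rhoM gP).
have [j YF] := Fall Y Y_fg Y_indec.
have MF := isomorphic_trans MY (restriction_isomorphic YF).
have jS : j \in S.
  rewrite inE; apply/asboolP; split.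
    exact: isomorphic_finitely_generated MF M_fg.
  exact: isomorphic_indecomposable MF M_indec.
by exists (enum_rank_in jS j); rewrite enum_rankK_in.
Qed.

End FiniteType.
End Corner.

(** * The algebra of a full subcategory as a corner *)

Section FullSubcategoryAlgebra.
Variables (k : fieldType) (C : finCat) (D : {set C}).
Local Notation A := (catalg k C).
Local Notation B := (catalg k (full_subcat D)).

Definition full_arr (m : mor (full_subcat D)) : mor C :=
  @arr C (val (tag m).1) (val (tag m).2) (tagged m).

Lemma full_arr_inj : injective full_arr.
Proof.
move=> [[x y] a] [[x' y'] a'] /[dup] e /arr_tag[/= /val_inj ex /val_inj ey].
by subst x' y'; rewrite /full_arr /= in e; rewrite (arr_inj e).
Qed.

(** This is extension by zero: the sum has at most one term, since [full_arr] is injective. *)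
Definition catalg_ext (b : B) : A :=
  [ffun m => \sum_(n | full_arr n == m) b n].

Definition catalg_res (a : A) : B := [ffun n => a (full_arr n)].

Lemma catalg_extE b n : catalg_ext b (full_arr n) = b n.
Proof.
by rewrite ffunE (big_pred1 n) // => n'; rewrite (inj_eq full_arr_inj).
Qed.

Lemma catalg_ext_out b (x y : C) (a : hom x y) :
  (x \notin D) || (y \notin D) -> catalg_ext b (arr a) = 0.
Proof.
move=> xyD; rewrite ffunE big_pred0 // => n; apply/eqP => /arr_tag[xE yE].
by move: xyD; rewrite -xE -yE !(valP (tag n).1, valP (tag n).2).
Qed.

Lemma catalg_extK : cancel catalg_ext catalg_res.
Proof. by move=> b; apply/ffunP => n; rewrite ffunE catalg_extE. Qed.

Lemma catalg_resK (a : A) :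
  (forall (x y : C) (c : hom x y),
    (x \notin D) || (y \notin D) -> a (arr c) = 0) ->
  catalg_ext (catalg_res a) = a.
Proof.
move=> a_out; apply: catalgP => x y c.
have [xyD|] := boolP ((x \notin D) || (y \notin D)).
  by rewrite catalg_ext_out // a_out.
rewrite negb_or !negbK => /andP[xD yD].
(* By fullness, [c] is itself a morphism of the subcategory. *)
pose n : mor (full_subcat D) := @arr (full_subcat D) (Sub x xD) (Sub y yD) c.
by rewrite -[arr c]/(full_arr n) catalg_extE ffunE.
Qed.

Fact catalg_ext_is_zmod_morphism : zmod_morphism catalg_ext.
Proof.
move=> a b; apply/ffunP => m; rewrite !ffunE -sumrB.
by apply: eq_bigr => n _; rewrite !ffunE.
Qed.
HB.instance Definition _ :=
  GRing.isZmodMorphism.Build B A catalg_ext catalg_ext_is_zmod_morphism.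

Fact catalg_res_is_zmod_morphism : zmod_morphism catalg_res.
Proof. by move=> a b; apply/ffunP => m; rewrite !ffunE. Qed.
HB.instance Definition _ :=
  GRing.isZmodMorphism.Build A B catalg_res catalg_res_is_zmod_morphism.

Lemma catalg_res1 : catalg_res 1 = 1.
Proof.
apply: catalgP => x y a; rewrite ffunE [RHS]catalg_oneE [LHS]catalg_oneE.
congr (nat_of_bool _)%:R.
exact: inj_eq full_arr_inj (arr a) (arr (idm x)).
Qed.

(** In general [catalg_res] is not multiplicative, because morphisms between objects of [D] may
    factor through objects outside [D]. Either hypothesis kills the terms with such a middle
    object. *)
Lemma catalg_resM (f g : A) :
  (forall (y z : C) (a : hom y z), y \notin D -> f (arr a) = 0) \/
  (forall (x y : C) (b : hom x y), y \notin D -> g (arr b) = 0) ->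
  catalg_res (f * g) = catalg_res f * catalg_res g.
Proof.
move=> fg_out; apply: catalgP => x z c.
rewrite ffunE [LHS]catalgME [RHS]catalgME (bigID (mem D)) /=.
rewrite [X in _ + X]big1 ?addr0 => [|y yD]; last first.
  rewrite big1 // => b _; rewrite big1 // => a _.
  by case: fg_out => ->; rewrite ?mul0r ?mulr0.
rewrite big_sub; apply: eq_bigr => y _; apply: eq_bigr => b _.
by apply: eq_bigr => a _; rewrite !ffunE.
Qed.

Lemma mul_catalg_ext_out (f : A) b (y z : C) (a : hom y z) :
  y \notin D -> (f * catalg_ext b) (arr a) = 0.
Proof.
move=> yD; rewrite catalgME big1 // => w _; rewrite big1 // => c _.
by rewrite big1 // => d _; rewrite [X in _ * X]catalg_ext_out ?yD // mulr0.
Qed.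

Lemma catalg_ext_mul_out (f : A) b (y z : C) (a : hom y z) :
  z \notin D -> (catalg_ext b * f) (arr a) = 0.
Proof.
move=> zD; rewrite catalgME big1 // => w _; rewrite big1 // => c _.
by rewrite big1 // => d _; rewrite catalg_ext_out ?zD ?orbT // mul0r.
Qed.

Lemma catalg_extM : {morph catalg_ext : a b / a * b}.
Proof.
move=> a b; rewrite -[RHS]catalg_resK => [|x y c /orP[xD|yD]].
- rewrite catalg_resM ?catalg_extK //; left => y z c yD.
  by rewrite catalg_ext_out ?yD.
- exact: mul_catalg_ext_out.
- exact: catalg_ext_mul_out.
Qed.

(** The factor [catalg_ext b] forces the middle objects of both products into [D]. *)
Lemma catalg_res_ext x b y :
  catalg_res (x * catalg_ext b * y) = catalg_res x * b * catalg_res y.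
Proof.
rewrite catalg_resM; last by left => ? ? ?; apply: mul_catalg_ext_out.
rewrite catalg_resM ?catalg_extK //; right => u v c vD.
by rewrite catalg_ext_out ?vD ?orbT.
Qed.

End FullSubcategoryAlgebra.

(** * The ground field acting through the category algebra *)

Section Scalars.
Variables (k : fieldType) (C : finCat).

Definition catalg_scalar (c : k) : catalg k C :=
  c *: (1 : catalg k C).

Fact catalg_scalar_is_zmod_morphism : zmod_morphism catalg_scalar.
Proof. by move=> c d; rewrite /catalg_scalar scalerBl. Qed.
HB.instance Definition _ := GRing.isZmodMorphism.Build k (catalg k C)
  catalg_scalar catalg_scalar_is_zmod_morphism.

Fact catalg_scalar_is_monoid_morphism : monoid_morphism catalg_scalar.
Proof.
split=> [|c d]; first by rewrite /catalg_scalar scale1r.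
by rewrite /catalg_scalar -catalg_scaleAl mul1r scalerA.
Qed.
HB.instance Definition _ := GRing.isMonoidMorphism.Build k (catalg k C)
  catalg_scalar catalg_scalar_is_monoid_morphism.

Lemma catalg_basis_span (a : catalg k C) : exists c : mor C -> k,
  a = \sum_m catalg_scalar (c m) * catalg_basis k m.
Proof.
(* An element of the algebra is its own family of coefficients. *)
exists a; apply/ffunP => n; rewrite sum_ffunE (bigD1 n) //= big1 => [|m mn].
  by rewrite addr0 -catalg_scaleAl mul1r !ffunE eqxx; apply/esym/mulr1.
rewrite -catalg_scaleAl mul1r !ffunE eq_sym (negbTE mn); exact: mulr0.
Qed.

End Scalars.

Theorem proposition6p1 (k : closedFieldType) (C : finCat)
    (hEI : is_EI C) (hconn : connected C) (hskel : skeletal C)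
    (D : {set C})
    (hD : infinite_representation_type k (full_subcat D)) :
  infinite_representation_type k C.
Proof.
move=> finC; apply: hD.
(* Here [iota] is extension by zero, [rho] is restriction of coefficients, and [eta] is the
   inclusion of scalar multiples of 1. *)
exact: (corner_finite_rep_type (@catalg_extM k C D) (@catalg_res1 k C D)
  (@catalg_res_ext k C D) (@catalg_basis_span k C) finC).
Qed.
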